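(* Let $H$ be a real Hilbert space, $C\subseteq H$ nonempty, closed and convex, and let $I=\{1,\dots,N\}$, $J=\{1,\dots,M\}$. Let $f_i:C\times C\to\mathbb{R}$ ($i\in I$) be bifunctions such that, for every $i\in I$: (A1) $f_i$ is pseudomonotone on $C$ and $f_i(x,x)=0$ for all $x\in C$; (A2) $f_i$ is Lipschitz-type continuous on $C$ with constants $c_1,c_2>0$ (the same for all $i$); (A3) $\limsup_{n\to\infty} f_i(x_n,y)\le f_i(x,y)$ for every $y\in C$ and every sequence $\{x_n\}\subset C$ converging weakly to $x$; (A4) for every fixed $x\in C$, $f_i(x,\cdot)$ is convex and subdifferentiable on $C$. Let $S_j:C\to C$ ($j\in J$) be mappings which are $\beta$-demicontractive on $C$, with $\beta\in[0,1)$ the same for all $j$, and demiclosed at zero. Let $F:C\to H$ be $\eta$-strongly monotone and $L$-Lipschitz continuous ($\eta,L>0$). Suppose $$\Omega:=\Big(\bigcap_{i\in I}EP(f_i,C)\Big)\cap\Big(\bigcap_{j\in J}Fix(S_j)\Big)\neq\emptyset .$$ Let $\rho$, $\{\alpha_n\}_{n\ge 0}$, $\{\beta_n^j\}_{n\ge0}$ ($j\in J$) be real parameters with $0<\rho<\min\{\frac1{2c_1},\frac1{2c_2}\}$; $\alpha_n>0$, $\lim_{n\to\infty}\alpha_n=0$, $\sum_{n=1}^\infty\alpha_n=+\infty$; and $0<a\le\beta_n^j<\frac{1-\beta}{2}$ for all $n,j$, for some constant $a$. Let $x_0\in C$ and let the sequence $\{x_n\}$ be generated, for $n=0,1,2,\dots$,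 by $$y_n^i=\operatorname{argmin}\{\rho f_i(x_n,y)+\tfrac12\|x_n-y\|^2: y\in C\},\quad i\in I,$$ $$z_n^i=\operatorname{argmin}\{\rho f_i(y_n^i,y)+\tfrac12\|x_n-y\|^2: y\in C\},\quad i\in I,$$ $$\bar z_n=z_n^{i_n}\ \text{ where } i_n\in I \text{ maximizes } \|z_n^i-x_n\| \text{ over } i\in I,\qquad t_n=\bar z_n-\alpha_nF(\bar z_n),$$ $$u_n^j=(1-\beta_n^j)t_n+\beta_n^jS_jt_n,\quad j\in J,$$ $$x_{n+1}=u_n^{j_n}\ \text{ where } j_n\in J \text{ maximizes } \|u_n^j-t_n\| \text{ over } j\in J.$$ Then $\{x_n\}$ converges strongly to the unique solution $x^*$ of the variational inequality problem for $F$ on $\Omega$, i.e. the unique $x^*\in\Omega$ with $\langle F(x^* ),y-x^*\rangle\ge0$ for all $y\in\Omega$.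
   Context: Notation: $EP(f,C)=\{x\in C: f(x,y)\ge0\ \forall y\in C\}$ and $Fix(S)=\{x\in C: S(x)=x\}$. A bifunction $f:C\times C\to\mathbb{R}$ is pseudomonotone on $C$ if $f(x,y)\ge0\Rightarrow f(y,x)\le0$ for all $x,y\in C$. It is Lipschitz-type continuous on $C$ with constants $c_1,c_2>0$ if $f(x,y)+f(y,z)\ge f(x,z)-c_1\|x-y\|^2-c_2\|y-z\|^2$ for all $x,y,z\in C$. A convex function $g:C\to\mathbb{R}$ is subdifferentiable on $C$ if for every $y\in C$ there is $w\in H$ with $g(z)\ge g(y)+\langle w,z-y\rangle$ for all $z\in C$. A mapping $S:C\to C$ is $\beta$-demicontractive ($\beta\in[0,1)$) if $Fix(S)\ne\emptyset$ and $\|S(x)-p\|^2\le\|x-p\|^2+\beta\|x-S(x)\|^2$ for all $p\in Fix(S)$, $x\in C$. It is demiclosed at zero if for each sequence $\{x_n\}\subset C$ converging weakly to $x$ with $\|S(x_n)-x_n\|\to0$ one has $S(x)=x$. $F:C\to H$ is $\eta$-strongly monotone if $\langle F(x)-F(y),x-y\rangle\ge\eta\|x-y\|^2$ and $L$-Lipschitz continuous if $\|F(x)-F(y)\|\le L\|x-y\|$, for all $x,y\in C$.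
   Formalization: Since S_j is defined only on C while t_n = z̄_n − α_n F(z̄_n) may leave C (making S_j t_n undefined), the formal theorem additionally assumes t_n ∈ C for all n. *)

(* Defs.v *)
From mathcomp Require Import all_boot all_order all_algebra.
From mathcomp Require Import sesquilinear.
From mathcomp Require Import all_classical all_reals all_analysis.

Set Implicit Arguments.
Unset Strict Implicit.
Unset Printing Implicit Defensive.

Import Order.TTheory GRing.Theory Num.Theory.
Import numFieldNormedType.Exports.

Local Open Scope classical_set_scope.
Local Open Scope ring_scope.

(** A real Hilbert space is a complete normed module [H] over a [realType]
    together with a positive definite symmetric bilinear form inducing the norm
    of [H].

    A map with domain [C] is represented by a total function on [H]; every
    definition below only constrains (or uses) its values on [C]. *)

Section Hilbert.
Context {R : realType} {H : completeNormedModType R}.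
Implicit Types (C : set H) (f : H -> H -> R) (g : H -> R) (S F : H -> H).

Definition induces_norm (dot : {dot H for @idfun R}) :=
  forall x : H, `|x| = Num.sqrt (dot x x).

Definition weak_cvg (u : nat -> H) (x : H) :=
  forall phi : {linear H -> R^o}, continuous phi ->
    phi (u n) @[n --> \oo] --> phi x.

Definition EP f C : set H := [set x | C x /\ forall y, C y -> 0 <= f x y].

Definition Fix S C : set H := [set x | C x /\ S x = x].

Definition pseudomonotone f C :=
  forall x y, C x -> C y -> 0 <= f x y -> f y x <= 0.

Definition Lipschitz_type f C (c1 c2 : R) :=
  forall x y z, C x -> C y -> C z ->
    f x y + f y z >= f x z - c1 * `|x - y| ^+ 2 - c2 * `|y - z| ^+ 2.

Definition weakly_usc_left f C :=
  forall y, C y -> forall (u : nat -> H) x, (forall n, C (u n)) ->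
    weak_cvg u x ->
    (limn_esup (fun n => (f (u n) y)%:E) <= (f x y)%:E)%E.

Definition subdifferentiable (dot : {dot H for @idfun R}) g C :=
  forall y, C y -> exists w, forall z, C z -> g z >= g y + dot w (z - y).

Definition demicontractive S C (beta : R) :=
  [/\ 0 <= beta < 1, Fix S C !=set0 &
    forall p x, Fix S C p -> C x ->
      `|S x - p| ^+ 2 <= `|x - p| ^+ 2 + beta * `|x - S x| ^+ 2].

Definition demiclosed_at_zero S C :=
  forall (u : nat -> H) x, (forall n, C (u n)) -> weak_cvg u x ->
    `|S (u n) - u n| @[n --> \oo] --> (0 : R) -> S x = x.

Definition strongly_monotone (dot : {dot H for @idfun R}) F C (eta : R) :=
  forall x y, C x -> C y -> dot (F x - F y) (x - y) >= eta * `|x - y| ^+ 2.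

Definition Lipschitz_continuous F C (L : R) :=
  forall x y, C x -> C y -> `|F x - F y| <= L * `|x - y|.

Definition argmin g C : set H :=
  [set y | C y /\ forall z, C z -> g y <= g z].

Definition VI (dot : {dot H for @idfun R}) F (Omega : set H) : set H :=
  [set x | Omega x /\ forall y, Omega y -> 0 <= dot (F x) (y - x)].

End Hilbert.

(* Main.v *)
(** For [p] in [Omega], one extragradient step followed by the gradient step of
    [F] and the relaxed demicontractive step yields, for large [n],
    [|x n.+1 - p|^2 <= (1 - alpha n * eta) |x n - p|^2
       + alpha n * (2 <F p, p - t n>) - residual n],
    where [residual n >= 0] controls [x n - y n i], [z n i - y n i] and
    [S j (t n) - t n] for all [i], [j]. Hence along any subsequence whose
    residuals vanish the weak cluster points of [t] lie in [Omega]. If [p]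
    solves the variational inequality, [2 <F p, p - t n>] is therefore
    eventually small whenever [residual n] is small; when [residual n] is not
    small it dominates the vanishing term [alpha n * (2 <F p, p - t n>)]. So for
    every [e > 0] the recursion eventually reads
    [s n.+1 <= (1 - alpha n * eta) s n + alpha n * eta * e], and divergence of
    the series of [alpha] forces [s n --> 0], without any case distinction on
    the monotonicity of [s]. *)

From HB Require Import structures.
Require Import Defs.
From mathcomp Require Import all_boot all_order all_algebra.
From mathcomp Require Import sesquilinear.
From mathcomp Require Import all_classical all_reals all_analysis.
From mathcomp Require Import ring lra.

Set Implicit Arguments.
Unset Strict Implicit.
Unset Printing Implicit Defensive.

Import Order.TTheory GRing.Theory Num.Theory.
Import numFieldNormedType.Exports.

Local Open Scope classical_set_scope.
Local Open Scope ring_scope.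

(** * Inner product calculus, proximal points and nearest points *)

Section InnerProduct.
Context {R : realType} {H : completeNormedModType R}.
Variable dot : {dot H for @idfun R}.
Implicit Types (x y z w : H) (a t A B : R) (C : set H).

Lemma dotC x y : dot x y = dot y x.
Proof. by rewrite hermC expr0 mul1r. Qed.

Lemma dotDl x y z : dot (x + y) z = dot x z + dot y z.
Proof. exact: linearDl. Qed.

Lemma dotNl x z : dot (- x) z = - dot x z.
Proof. exact: linearNl. Qed.

Lemma dotZl a x z : dot (a *: x) z = a * dot x z.
Proof. exact: linearZl_LR. Qed.

Lemma dotDr x y z : dot x (y + z) = dot x y + dot x z.
Proof. by rewrite dotC dotDl !(dotC x). Qed.

Lemma dotNr x z : dot x (- z) = - dot x z.
Proof. by rewrite dotC dotNl (dotC x). Qed.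

Lemma dotZr a x z : dot x (a *: z) = a * dot x z.
Proof. by rewrite dotC dotZl (dotC x). Qed.

Lemma dot0r x : dot x 0 = 0.
Proof. by rewrite dotC linear0l. Qed.

Definition dotE := (dotDl, dotDr, dotNl, dotNr, dotZl, dotZr).

Lemma dot_ge0 x : 0 <= dot x x.
Proof.
have [->|x0] := eqVneq x 0; first by rewrite linear0l.
apply: ltW; exact: neq0_dnorm_gt0.
Qed.

Lemma dot_eq0 x : dot x x = 0 -> x = 0.
Proof.
move=> xx0; apply/eqP/negPn/negP => /(neq0_dnorm_gt0 (s:=dot)).
by rewrite xx0 ltxx.
Qed.

Hypothesis Hdot : induces_norm dot.

Lemma norm_sqE x : `|x| ^+ 2 = dot x x.
Proof. by rewrite Hdot sqr_sqrtr// dot_ge0. Qed.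

Lemma norm_sqD x y : `|x + y| ^+ 2 = `|x| ^+ 2 + 2 * dot x y + `|y| ^+ 2.
Proof. by rewrite !norm_sqE !dotE (dotC y x); ring. Qed.

Lemma norm_sqB x y : `|x - y| ^+ 2 = `|x| ^+ 2 - 2 * dot x y + `|y| ^+ 2.
Proof. by rewrite norm_sqD dotNr normrN; ring. Qed.

Lemma dot_le_norm x y : dot x y <= `|x| * `|y|.
Proof.
have [->|x0] := eqVneq x 0; first by rewrite linear0l normr0 mul0r.
have [->|y0] := eqVneq y 0; first by rewrite dot0r normr0 mulr0.
have xy0 : 0 < `|x| * `|y| by rewrite mulr_gt0 ?normr_gt0.
(* Cauchy-Schwarz: this square equals 2 |x| |y| (|x| |y| - [dot x y]). *)
have := exprn_ge0 2 (normr_ge0 (`|y| *: x - `|x| *: y)).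
rewrite norm_sqB !dotE !normrZ !normr_id => h.
by rewrite -(ler_pM2l xy0) -subr_ge0; nra.
Qed.

Lemma abs_dot_le_norm x y : `|dot x y| <= `|x| * `|y|.
Proof.
rewrite ler_norml dot_le_norm andbT lerNl -dotNl -[`|x|]normrN.
exact: dot_le_norm.
Qed.

(** Young's inequality with a free weight, to be tuned in [iterates_bounded]. *)
Lemma dot_le_sq x y (a0 : R) : 0 < a0 ->
  2 * dot x y <= a0 * `|x| ^+ 2 + a0^-1 * `|y| ^+ 2.
Proof.
move=> a0_gt0; rewrite -(ler_pM2l a0_gt0) mulrDr !mulrA divff ?gt_eqF// mul1r.
have := exprn_ge0 2 (normr_ge0 (a0 *: x - y)).
by rewrite norm_sqB dotE normrZ (gtr0_norm a0_gt0); nra.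
Qed.

Lemma bounded_linear_continuous (phi : H -> R) B :
  (forall a u v, phi (a *: u + v) = a * phi u + phi v) ->
  (forall v, `|phi v| <= B * `|v|) -> continuous phi.
Proof.
move=> linphi phiB x; apply/cvgrPdist_lt => e e0; near=> y.
have -> : phi x - phi y = phi (x - y).
  by rewrite [x - y]addrC -(scaleN1r y) linphi mulN1r addrC.
apply: le_lt_trans (phiB _) _.
apply: (@le_lt_trans _ _ ((`|B| + 1) * `|x - y|)).
  by rewrite ler_wpM2r// (le_trans (ler_norm _))// lerDl.
rewrite -ltr_pdivlMl ?ltr_wpDl//; near: y.
by apply: cvgr_dist_lt => //; rewrite mulr_gt0// invr_gt0 ltr_wpDl.
Unshelve. all: end_near. Qed.

Lemma continuous_dot w : continuous (dot w : H -> R).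
Proof.
apply: bounded_linear_continuous (abs_dot_le_norm w) => a u v.
by rewrite dotDr dotZr.
Qed.

(** The codomain [R^o] makes [dot w] one of the functionals over which [weak_cvg] quantifies. *)
Definition dot_lin w : H -> R^o := dot w.

Fact dot_lin_is_linear w : linear (dot_lin w).
Proof. by move=> a x y; rewrite /dot_lin dotDr dotZr. Qed.

HB.instance Definition _ w :=
  GRing.isLinear.Build R H R^o *:%R (dot_lin w) (dot_lin_is_linear w).

Lemma weak_cvg_dot (u : nat -> H) x w : weak_cvg u x ->
  dot w (u n) @[n --> \oo] --> dot w x.
Proof. by move=> /(_ (dot_lin w)); apply; exact: continuous_dot. Qed.

Lemma weak_cvg_add (u v : nat -> H) x : weak_cvg u x ->
  v n - u n @[n --> \oo] --> (0 : H) -> weak_cvg v x.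
Proof.
move=> ux vu phi cphi.
have -> : (fun n => phi (v n)) = (fun n => phi (u n) + phi (v n - u n)).
  by apply/funext => n; rewrite linearB addrC subrK.
rewrite -[phi x]addr0; apply: cvgD; first exact: ux.
by rewrite -(linear0 phi); apply: (cvg_comp _ _ vu); exact: cphi.
Qed.

Lemma le0_of_le_small A B :
  (forall t, 0 < t <= 1 -> A <= t * B) -> A <= 0.
Proof.
move=> AB; rewrite leNgt; apply/negP => A0.
have := AB 1; rewrite ltr01 lexx mul1r => /(_ isT) leAB.
have B0 : 0 < B by exact: lt_le_trans leAB.
(* The case t = 1 gave A <= B, so t = A / (2 B) is admissible; it yields A <= A / 2. *)
have := AB (A / (2 * B)); rewrite divr_gt0 ?mulr_gt0// ler_pdivrMr ?mulr_gt0//.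
have -> : A / (2 * B) * B = A / 2 by field; rewrite gt_eqF.
by move=> /(_ ltac:(lra)); lra.
Qed.

Lemma convex_setE C x y t : convex_set C -> C x -> C y ->
  0 <= t <= 1 -> C (t *: x + (1 - t) *: y).
Proof.
move=> cC /mem_set xC /mem_set yC /andP[t0 t1].
exact: set_mem (cC x y (Itv01 t0 t1) xC yC).
Qed.

Lemma convex_functionE C (g : H -> R) x y t : convex_function C g ->
  C x -> C y -> 0 <= t <= 1 ->
  g (t *: x + (1 - t) *: y) <= t * g x + (1 - t) * g y.
Proof.
move=> cg /mem_set xC /mem_set yC /andP[t0 t1].
exact: cg (Itv01 t0 t1) x y xC yC.
Qed.

(** First-order optimality: comparing [p] with [t *: v + (1 - t) *: p] and dividing by [t] leaves an
    error t |v - p|^2 / 2, which vanishes with t. *)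
Lemma argmin_prox C (g : H -> R) (rho : R) x p :
  convex_set C -> convex_function C g -> 0 <= rho ->
  argmin (fun v => rho * g v + 1 / 2 * `|x - v| ^+ 2) C p ->
  forall v, C v -> dot (x - p) (v - p) <= rho * (g v - g p).
Proof.
move=> cC cg rho0 [Cp pmin] v Cv; rewrite -subr_le0.
apply: (@le0_of_le_small _ (1 / 2 * `|v - p| ^+ 2)) => t /andP[t0 t1].
have t01 : 0 <= t <= 1 by rewrite ltW.
have := pmin _ (convex_setE cC Cv Cp t01).
have := ler_wpM2l rho0 (convex_functionE cg Cv Cp t01).
have -> : x - (t *: v + (1 - t) *: p) = (x - p) - t *: (v - p).
  rewrite scalerBl scale1r scalerBr opprD !opprB.
  by rewrite (addrC (- (t *: v))) (addrC (t *: p)) !addrA.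
rewrite (norm_sqB (x - p)) dotZr normrZ (gtr0_norm t0) exprMn.
move=> gle ple; rewrite -(ler_pM2l t0); nra.
Qed.

Lemma exists_nearest C x : closed C -> convex_set C -> C !=set0 ->
  exists p, C p /\ forall v, C v -> `|x - p| ^+ 2 <= `|x - v| ^+ 2.
Proof.
move=> clC cC [c0 Cc0].
pose D := [set `|x - v| ^+ 2 | v in C].
have D0 : D !=set0 by exists (`|x - c0| ^+ 2), c0.
have Dlb : has_lbound D by exists 0 => _ [v _ <-]; rewrite exprn_ge0.
have infD v : C v -> inf D <= `|x - v| ^+ 2.
  by move=> Cv; apply: ge_inf => //; exists v.
have : forall n, exists v, C v /\ `|x - v| ^+ 2 < inf D + n.+1%:R^-1.
  move=> n; have : inf D < inf D + n.+1%:R^-1 by rewrite ltrDl invr_gt0.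
  by move=> /(inf_lt D0)[_ [v Cv <-] vD]; exists v.
move=> /choice[v vP].
have Cv n : C (v n) by case: (vP n).
(* The midpoint lies in [C], so its squared distance to [x] is at least [inf D]; the parallelogram
   identity then shows that the minimizing sequence is Cauchy. *)
have midpoint n m : `|v n - v m| ^+ 2 <= 2 * (n.+1%:R^-1 + m.+1%:R^-1).
  have := infD _ (convex_setE cC (Cv n) (Cv m) (_ : 0 <= 1 / 2 <= 1)).
  move=> /(_ ltac:(lra)).
  have -> : x - (1 / 2 *: v n + (1 - 1 / 2) *: v m) =
      (1 / 2) *: ((x - v n) + (x - v m)).
    have -> : 1 - 1 / 2 = 1 / 2 :> R by field.
    rewrite -scalerDr addrACA -opprD scalerBr; congr (_ - _).
    by rewrite -mulr2n -(scaler_nat 2 x) scalerA mul1r mulVf ?scale1r.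
  rewrite normrZ exprMn (norm_sqD (x - v n)) [`|1 / 2|]ger0_norm; last by lra.
  have -> : v n - v m = (x - v m) - (x - v n).
    by rewrite opprB [RHS]addrC addrA subrK.
  rewrite (norm_sqB (x - v m)) (dotC (x - v m)).
  move: (vP n).2 (vP m).2; move: (n.+1%:R^-1 : R) (m.+1%:R^-1 : R) => en em.
  by move=> *; lra.
have vcvg : cvgn v.
  apply/cauchy_cvgP/cauchy_exP => e e0.
  have e2 : 0 < e ^+ 2 / 4 by rewrite divr_gt0// exprn_gt0.
  have [n0 _ n0P] := near_infty_natSinv_lt (PosNum e2).
  exists (v n0); exists n0 => // n /= n0n; rewrite -ball_normE /=.
  rewrite -(@ltr_pXn2r _ 2) ?nnegrE ?normr_ge0 ?(ltW e0)//.
  apply: le_lt_trans (midpoint _ _) _.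
  move: (n0P _ n0n) (n0P n0 (leqnn _)) => /=.
  by move: (n.+1%:R^-1 : R) (n0.+1%:R^-1 : R) => en en0 *; lra.
exists (limn v); split.
  by apply: (closed_cvg _ clC _ _ vcvg); exact: nearW.
move=> w Cw; apply: le_trans (infD _ Cw).
apply/ler_addgt0Pr => e e0.
have nvcvg : `|x - v n| ^+ 2 @[n --> \oo] --> `|x - limn v| ^+ 2.
  have nv : `|x - v n| @[n --> \oo] --> `|x - limn v|.
    by apply: cvg_norm; apply: cvgB => //; exact: cvg_cst.
  by rewrite expr2; under eq_fun do rewrite expr2; exact: cvgM.
apply: (cvgr_to_le nvcvg).
have [n0 _ n0P] := near_infty_natSinv_lt (PosNum e0).
exists n0 => // n /= /n0P /= ne; have [_ /ltW vn] := vP n.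
by apply: le_trans vn _; rewrite lerD ?infD// ltW.
Qed.

End InnerProduct.

(** * Projections, Riesz representation and weak sequential compactness *)

Section WeakCompactness.
Context {R : realType} {H : completeNormedModType R}.
Variable dot : {dot H for @idfun R}.
Hypothesis Hdot : induces_norm dot.
Implicit Types (x y z w : H) (C V : set H).

Lemma exists_proj C x : closed C -> convex_set C -> C !=set0 ->
  exists p, C p /\ forall v, C v -> dot (x - p) (v - p) <= 0.
Proof.
move=> clC cC C0; have [p [Cp pmin]] := exists_nearest Hdot x clC cC C0.
(* A nearest point is a proximal point of the zero function: take [rho = 0] and [g = 0] in
   [argmin_prox]. *)
exists p; split => // v Cv; rewrite -[leRHS](mul0r (0 - 0)).
apply: (argmin_prox Hdot (C := C) (g := fun=> 0)) => //.
  by move=> t a b _ _; rewrite convmm.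
by split => // w Cw; rewrite mulr0 !add0r ler_pM2l// pmin.
Qed.

Lemma exists_orthogonal_proj V x : closed V -> V 0 ->
  (forall a u v, V u -> V v -> V (a *: u + v)) ->
  exists p, V p /\ forall v, V v -> dot (x - p) v = 0.
Proof.
move=> clV V0 linV.
have cV : convex_set V.
  move=> a b t /set_mem Va /set_mem Vb; apply/mem_set/linV => //.
  by rewrite -[X in V X]addr0; exact: linV.
have [p [Vp pP]] := exists_proj x clV cV (ex_intro _ 0 V0).
exists p; split => // v Vv; apply/eqP; rewrite eq_le.
have := pP _ (linV 1 _ _ Vv Vp); have := pP _ (linV (-1) _ _ Vv Vp).
by rewrite !addrK scale1r scaleN1r dotNr oppr_le0 => -> ->.
Qed.

Lemma riesz_representation (phi : H -> R) :
  (forall a u v, phi (a *: u + v) = a * phi u + phi v) -> continuous phi ->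
  exists w, forall v, phi v = dot w v.
Proof.
move=> linphi cphi.
have phi0 : phi 0 = 0.
  by have := linphi 1 0 0; rewrite scaler0 addr0 mul1r => /eqP;
    rewrite -subr_eq0 opprD addNKr oppr_eq0 => /eqP.
have [phiz|/existsNP[z /eqP phiz]] := pselect (forall v, phi v = 0).
  by exists 0 => v; rewrite linear0l.
have clK : closed [set v | phi v = 0].
  by apply: (@preimage_closed _ _ phi [set 0]) => //; exact: closed_eq.
have [|p [/= phip pP]] := exists_orthogonal_proj z clK phi0.
  by move=> a u v /= phiu phiv; rewrite linphi phiu phiv mulr0 addr0.
pose e := z - p.
have phie : phi e = phi z.
  by rewrite /e addrC -(scaleN1r p) linphi phip mulr0 add0r.
have ee : dot e e != 0.
  by apply: contraNneq phiz => /dot_eq0 e0; rewrite -phie e0 phi0.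
exists ((phi e / dot e e) *: e) => v.
(* [phi v *: e - phi e *: v] is in the kernel, to which [e] is orthogonal; adding 0 gives the shape
   required by [linphi]. *)
have: dot e (- phi e *: v + (phi v *: e + 0)) = 0.
  by apply: pP; rewrite /= !linphi phi0 addr0 mulNr mulrC addNr.
move: e phie ee => e _ ee; rewrite addr0 dotDr !dotZr => orth.
apply: (mulIf ee); rewrite dotZl.
have -> : phi e / dot e e * dot e v * dot e e = phi e * dot e v by field.
lra.
Qed.

Lemma weak_cvgP (u : nat -> H) x :
  weak_cvg u x <-> forall w, dot w (u n) @[n --> \oo] --> dot w x.
Proof.
split=> [ux w|ux phi cphi]; first exact: weak_cvg_dot.
have [a v1 v2|w wE] := riesz_representation _ cphi.
  by rewrite linearP.
by under eq_fun do rewrite wE; rewrite wE; exact: ux.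
Qed.

(** Compactness of the segment gives a cluster point, and an ultrafilter converges to each of its
    cluster points. *)
Lemma ultra_bounded_cvg (U : set_system nat) (s : nat -> R) K :
  UltraFilter U -> (forall n, `|s n| <= K) ->
  exists l : R, s n @[n --> U] --> l.
Proof.
move=> UU sK; have UP : ProperFilter U by exact: ultra_proper.
have : compact `[- K, K]%classic by exact: segment_compact.
move=> /(_ (s @ U) (fmap_proper_filter s UP)) [|l [_ scl]].
  by apply: (@filterE _ U) => n /=; rewrite in_itv /= -ler_norml.
exists l => A lA; have [//|UnA] := in_ultra_setVsetC (s @^-1` A) UU.
by have [r [/= nAr /nAr]] := scl (~` A) A UnA lA.
Qed.

(** The limits of [dot w (u n)] are linear and bounded in [w]; Riesz representation turns them into
    a vector. *)
Lemma bounded_weak_cvg_ultra (U : set_system nat) (u : nat -> H) B :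
  UltraFilter U -> (forall n, `|u n| <= B) ->
  exists x, forall w, dot w (u n) @[n --> U] --> dot w x.
Proof.
move=> UU uB; have UP : ProperFilter U by exact: ultra_proper.
have dotB w n : `|dot w (u n)| <= B * `|w|.
  by apply: le_trans (abs_dot_le_norm Hdot _ _) _; rewrite mulrC ler_wpM2r.
have /choice[phi phiP] : forall w, exists l : R,
  dot w (u n) @[n --> U] --> l.
  by move=> w; exact: ultra_bounded_cvg (dotB w).
have linphi a v w : phi (a *: v + w) = a * phi v + phi w.
  apply: (cvg_unique _ (phiP _)) => //=.
  under eq_fun do rewrite dotDl dotZl.
  by apply: cvgD => //; apply: cvgM => //; exact: cvg_cst.
have phiB w : `|phi w| <= B * `|w|.
  by apply: (cvgr_to_le (cvg_norm (phiP w))); exact: nearW.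
have [x xE] :=
  riesz_representation linphi (bounded_linear_continuous linphi phiB).
by exists x => w; rewrite dotC -xE.
Qed.

(* The limit [x] is taken along an ultrafilter, and [g k] is an index at which
   [u - x] is small against [u 0, ..., u k.-1]. The vectors [v] against which
   [u (g k) - x] tends to 0 then form a closed subspace containing every [u m],
   and a vector orthogonal to it is orthogonal to [x] as well. *)
Lemma bounded_weak_cvg_subseq (u : nat -> H) B : (forall n, `|u n| <= B) ->
  exists (g : nat -> nat) x,
    (forall k, (k <= g k)%N) /\ weak_cvg (fun k => u (g k)) x.
Proof.
move=> uB; have [U [UU ooU]] := ultraFilterLemma eventually_filter.
have UP : ProperFilter U by exact: ultra_proper.
have [x xP] := bounded_weak_cvg_ultra UU uB.
have close_to k : exists n, (k <= n)%N /\
    forall m : 'I_k, `|dot (u m) (u n - x)| < k.+1%:R^-1.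
  apply: (@filter_ex _ U).
  apply: (@filterI _ U _ [set n | (k <= n)%N]); first by apply: ooU; exists k.
  apply: filter_forall => m.
  have k0 : 0 < k.+1%:R^-1 :> R by rewrite invr_gt0.
  by have /cvgrPdistC_lt/(_ _ k0) := xP (u m); apply: filterS => n;
    rewrite dotDr dotNr.
have [g gP] := choice close_to.
exists g, x; split=> [k|]; first by case: (gP k).
apply/weak_cvgP.
pose V := [set v | dot v (u (g k) - x) @[k --> \oo] --> (0 : R)].
suff VT w : V w.
  move=> w; apply/subr_cvg0; under eq_fun do rewrite -dotNr -dotDr.
  exact: VT.
have Vlin a v1 v2 : V v1 -> V v2 -> V (a *: v1 + v2).
  move=> V1 V2; rewrite /V /=; under eq_fun do rewrite dotDl dotZl.
  rewrite -[0]addr0 -[X in X + _](mulr0 a).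
  by apply: cvgD => //; apply: cvgM => //; exact: cvg_cst.
have V0 : V 0.
  by rewrite /V /=; under eq_fun do rewrite linear0l; exact: cvg_cst.
have Vu m : V (u m).
  apply/cvgrPdistC_lt => e e0; near=> k; rewrite subr0.
  have mk : (m < k)%N by near: k; exact: nbhs_infty_gt.
  apply: lt_trans ((gP k).2 (Ordinal mk)) _; near: k.
  exact: (near_infty_natSinv_lt (PosNum e0)).
have Vcl : closed V.
  move=> v clv; apply/cvgrPdistC_lt => e e0; pose K := B + `|x| + 1.
  have K0 : 0 < K.
    by rewrite ltr_wpDl// addr_ge0// (le_trans _ (uB 0%N)).
  have e2K : 0 < e / 2 / K by rewrite !divr_gt0.
  have [v' [Vv' vv']] := clv _ (nbhsx_ballx v _ e2K).
  near=> k; rewrite subr0 -[v](subrK v') dotDl.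
  apply: le_lt_trans (ler_normD _ _) _; rewrite [e]splitr ltrD//.
    apply: le_lt_trans (abs_dot_le_norm Hdot _ _) _.
    apply: (@le_lt_trans _ _ (`|v - v'| * K)).
      rewrite ler_wpM2l// (le_trans (ler_normB _ _))//.
      by rewrite /K -addrA lerD// lerDl.
    by rewrite -ltr_pdivlMr//; move: vv'; rewrite -ball_normE.
  rewrite -[X in `|X|]subr0; near: k.
  by have /cvgrPdistC_lt := Vv'; apply; rewrite divr_gt0.
have [p [Vp pP]] := exists_orthogonal_proj w Vcl V0 Vlin.
rewrite -[w](subrK p) -[w - p]scale1r; apply: Vlin => //.
have wx0 : dot (w - p) x = 0.
  apply: (cvg_unique _ (xP _)) => //=.
  by under eq_fun do rewrite pP//; exact: cvg_cst.
rewrite /V /=; under eq_fun do rewrite dotDr dotNr wx0 pP// subr0.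
exact: cvg_cst.
Unshelve. all: end_near. Qed.

(** With [p] the projection of [x], the inequality [dot (x - p) (u n - p) <= 0] survives the weak
    limit and becomes |x - p|^2 <= 0. *)
Lemma weakly_closed_convex C (u : nat -> H) x : closed C -> convex_set C ->
  (forall n, C (u n)) -> weak_cvg u x -> C x.
Proof.
move=> clC cC Cu ux.
have [p [Cp pP]] := exists_proj x clC cC (ex_intro _ _ (Cu 0%N)).
suff /eqP : dot (x - p) (x - p) = 0.
  by move=> /eqP /dot_eq0 /eqP; rewrite subr_eq0 => /eqP ->.
apply/eqP; rewrite eq_le dot_ge0 andbT.
rewrite [X in X <= _]dotDr dotNr subr_le0.
apply: (cvgr_to_le (weak_cvg_dot (w := x - p) Hdot ux)); apply: nearW => n.
by rewrite -subr_le0 -dotNr -dotDr pP.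
Qed.

End WeakCompactness.

(** * Geometry of equilibrium and fixed-point sets; relaxation and gradient estimates *)

Section Equilibrium.
Context {R : realType} {H : completeNormedModType R}.
Variable dot : {dot H for @idfun R}.
Hypothesis Hdot : induces_norm dot.
Implicit Types (x y z w p v : H) (C Om : set H) (f : H -> H -> R).

Lemma cvg_weak_cvg (u : nat -> H) x : u n @[n --> \oo] --> x -> weak_cvg u x.
Proof. by move=> ux phi cphi; apply: (cvg_comp _ _ ux); exact: cphi. Qed.

Lemma seq_closed (A : set H) :
  (forall u x, (forall n, A (u n)) -> u n @[n --> \oo] --> x -> A x) ->
  closed A.
Proof.
move=> seqA x clx.
have /choice[u uP] : forall n, exists v, A v /\ `|x - v| < n.+1%:R^-1.
  move=> n; have n0 : 0 < n.+1%:R^-1 :> R by rewrite invr_gt0.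
  have [v [Av xv]] := clx _ (nbhsx_ballx x _ n0).
  by exists v; split => //; move: xv; rewrite -ball_normE.
apply: (seqA u) => [n|]; first by case: (uP n).
apply/cvgrPdist_lt => e e0; near=> n; apply: lt_trans (uP n).2 _; near: n.
exact: (near_infty_natSinv_lt (PosNum e0)).
Unshelve. all: end_near. Qed.

(** Each tail supremum of [f (u n) y] dominates its first term, hence eventually -d, so the limit
    superior is at least -d for every d > 0. *)
Lemma weakly_usc_ge0 f C (u : nat -> H) (e : nat -> R) x y :
  weakly_usc_left f C -> C y -> (forall n, C (u n)) -> weak_cvg u x ->
  e n @[n --> \oo] --> (0 : R) -> (forall n, e n <= f (u n) y) -> 0 <= f x y.
Proof.
move=> uscf Cy Cu ux e0 ef; have := uscf _ Cy _ _ Cu ux.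
rewrite limn_esup_lim => sup_le; apply/ler_addgt0Pr => d d0.
rewrite -lerBlDr sub0r -lee_fin; apply: le_trans sup_le.
apply: lime_ge; first exact: is_cvg_esups.
have /cvgrPdistC_lt/(_ _ d0) := e0; apply: filterS => n.
rewrite subr0 ltr_norml => /andP[/ltW den _].
apply: (@le_trans _ _ (f (u n) y)%:E).
  by rewrite lee_fin (le_trans den).
by apply: ereal_sup_ubound; exists n => /=.
Qed.

(** Minty's lemma. For the converse put u = r y + (1 - r) x: then 0 = f(u,u) <= r f(u,y) + (1 - r)
    f(u,x) forces f(u,y) >= 0, and r tends to 0. The right-hand form is a convex condition on [x],
    whence [EP_convex]. *)
Lemma EP_minty f C x : convex_set C -> pseudomonotone f C ->
  (forall y, C y -> f y y = 0) -> weakly_usc_left f C ->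
  (forall y, C y -> convex_function C (f y)) -> C x ->
  EP f C x <-> forall y, C y -> f y x <= 0.
Proof.
move=> cC pmf f0 uscf cf Cx; split=> [[_ fx] y Cy|fx].
  exact: pmf Cx Cy (fx _ Cy).
split=> // y Cy; pose r n : R := n.+1%:R^-1.
have r01 n : 0 < r n <= 1 by rewrite /r invr_gt0 ltr0Sn invf_le1 ?ler1n.
pose u n := r n *: y + (1 - r n) *: x.
have Cu n : C (u n).
  by apply: convex_setE => //; case/andP: (r01 n) => /ltW -> ->.
have ux : u n @[n --> \oo] --> x.
  rewrite -[x]add0r -(scale0r y) -[X in _ + X]scale1r -[X in X *: x]subr0.
  have r0 : r n @[n --> \oo] --> (0 : R) by exact: cvg_harmonic.
  apply: cvgD; first by apply: cvgZ => //; exact: cvg_cst.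
  by apply: cvgZ; [apply: cvgB => //|]; exact: cvg_cst.
apply: (@weakly_usc_ge0 f C u (fun=> 0)) => //.
- exact: cvg_weak_cvg.
- exact: cvg_cst.
move=> n; have /andP[rn0 rn1] := r01 n.
have rn : 0 <= r n <= 1 by rewrite ltW.
have := convex_functionE (cf _ (Cu n)) Cy Cx rn.
rewrite -/(u n) f0// => fu; rewrite -(pmulr_rge0 _ rn0).
have : (1 - r n) * f (u n) x <= 0 by rewrite mulr_ge0_le0 ?subr_ge0 ?fx.
by lra.
Qed.

Lemma EP_convex f C : convex_set C -> pseudomonotone f C ->
  (forall y, C y -> f y y = 0) -> weakly_usc_left f C ->
  (forall y, C y -> convex_function C (f y)) -> convex_set (EP f C).
Proof.
move=> cC pmf f0 uscf cf x y t /set_mem xEP /set_mem yEP; apply/mem_set.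
have [Cx Cy] := (xEP.1, yEP.1).
have /set_mem Cxy := cC _ _ t (mem_set Cx) (mem_set Cy).
apply/EP_minty => // z Cz.
have fzx : f z x <= 0 by apply: (EP_minty _ _ _ _ _ Cx).1.
have fzy : f z y <= 0 by apply: (EP_minty _ _ _ _ _ Cy).1.
apply: le_trans (cf _ Cz t _ _ (mem_set Cx) (mem_set Cy)) _.
rewrite convRE -[leRHS]addr0 lerD// mulr_ge0_le0//.
by rewrite subr_ge0.
Qed.

Lemma EP_closed f C : closed C -> weakly_usc_left f C -> closed (EP f C).
Proof.
move=> clC uscf; apply: seq_closed => u x uEP ux; split.
  by apply: (closed_cvg _ clC _ _ ux); apply: nearW => n; have [] := uEP n.
move=> y Cy; apply: (@weakly_usc_ge0 f C u (fun=> 0)) => //.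
- by move=> n; have [] := uEP n.
- exact: cvg_weak_cvg.
- exact: cvg_cst.
by move=> n; apply: (uEP n).2.
Qed.

(** Expanding |S x - p|^2 around [x] gives a form of demicontractivity that is affine in [p]. *)
Lemma demicontractive_dot S C beta x p : demicontractive S C beta ->
  Fix S C p -> C x ->
  (1 - beta) * `|x - S x| ^+ 2 <= 2 * dot (x - p) (x - S x).
Proof.
move=> [_ _ demi] Fp Cx; have := demi _ _ Fp Cx.
have -> : S x - p = (x - p) - (x - S x) by rewrite opprB [RHS]addrC addrA subrK.
by rewrite (norm_sqB Hdot (x - p)) => *; lra.
Qed.

(** At the convex combination [w], weighting [demicontractive_dot] for the two fixed points by t and
    1 - t cancels the inner products, as t (w - x) + (1 - t) (w - y) = 0. *)
Lemma Fix_convex S C beta :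
  convex_set C -> demicontractive S C beta -> convex_set (Fix S C).
Proof.
move=> cC demi x y t /set_mem Fx /set_mem Fy; apply/mem_set.
have [Cx Cy] := (Fx.1, Fy.1).
have /set_mem Cxy := cC _ _ t (mem_set Cx) (mem_set Cy).
split => //; have [/andP[_ beta1] _ _] := demi.
set w := (conv t x y) in Cxy *.
have wx := demicontractive_dot demi Fx Cxy.
have wy := demicontractive_dot demi Fy Cxy.
have t0 : 0 <= t%:num by [].
have t1 : 0 <= 1 - t%:num by rewrite subr_ge0.
have : t%:num *: (w - x) + (1 - t%:num) *: (w - y) = 0.
  rewrite !scalerBr addrACA -opprD -scalerDl addrC.
  by rewrite [t%:num + _]addrC subrK scale1r addNr.
move=> /(congr1 (fun v => dot v (w - S w))).
rewrite linear0l dotDl !dotZl => wxy.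
have Sw0 : `|w - S w| ^+ 2 <= 0 by nra.
apply/eqP; rewrite eq_sym -subr_eq0 -normr_eq0 -sqrf_eq0.
by rewrite eq_le Sw0 exprn_ge0.
Qed.

Lemma Fix_closed S C : closed C -> demiclosed_at_zero S C -> closed (Fix S C).
Proof.
move=> clC demi; apply: seq_closed => u x uF ux; split.
  by apply: (closed_cvg _ clC _ _ ux); apply: nearW => n; have [] := uF n.
apply: demi (cvg_weak_cvg ux) _ => [n|]; first by have [] := uF n.
under eq_fun do rewrite (uF _).2 subrr normr0.
exact: cvg_cst.
Qed.

Lemma relaxation_le S C beta (b : R) t p : demicontractive S C beta ->
  Fix S C p -> C t -> 0 <= b ->
  `|(1 - b) *: t + b *: S t - p| ^+ 2 <=
  `|t - p| ^+ 2 - b * (1 - beta - b) * `|t - S t| ^+ 2.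
Proof.
move=> demi Fp Ct b0.
have -> : (1 - b) *: t + b *: S t - p = (t - p) - b *: (t - S t).
  rewrite scalerBl scale1r scalerBr opprB -!addrA; congr (_ + _).
  by rewrite addrA addrC [_ + b *: S t]addrC.
rewrite (norm_sqB Hdot (t - p)) dotZr normrZ exprMn real_normK ?num_real//.
by have := ler_wpM2l b0 (demicontractive_dot demi Fp Ct); lra.
Qed.

(** Expansion gives the factor 1 - 2 al eta + al^2 L^2; the smallness of [al] absorbs the last term
    into one al eta. *)
Lemma gradient_step_le (F : H -> H) C eta L (al : R) x y :
  strongly_monotone dot F C eta -> Lipschitz_continuous F C L ->
  0 < L -> C x -> C y -> 0 <= al -> al * L ^+ 2 <= eta ->
  `|(x - al *: F x) - (y - al *: F y)| ^+ 2 <=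
  (1 - al * eta) * `|x - y| ^+ 2.
Proof.
move=> monoF lipF L0 Cx Cy al0 alL.
have -> : (x - al *: F x) - (y - al *: F y) = (x - y) - al *: (F x - F y).
  by rewrite scalerBr !opprB [al *: F y - y]addrC addrACA (addrC (- (al *: _))).
rewrite (norm_sqB Hdot (x - y)) dotZr dotC normrZ exprMn real_normK ?num_real//.
have mono := ler_wpM2l al0 (monoF _ _ Cx Cy).
have lip : `|F x - F y| ^+ 2 <= L ^+ 2 * `|x - y| ^+ 2.
  by rewrite -exprMn lerXn2r ?nnegrE ?mulr_ge0 ?normr_ge0 ?(ltW L0)// lipF.
have := ler_wpM2l al0 lip; move=> /(ler_wpM2l al0).
have := ler_wpM2r (exprn_ge0 2 (normr_ge0 (x - y))) alL.
move=> /(ler_wpM2l al0); lra.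
Qed.

End Equilibrium.

(** * Unique solvability of the variational inequality *)

Section VariationalInequality.
Context {R : realType} {H : completeNormedModType R}.
Variable dot : {dot H for @idfun R}.
Hypothesis Hdot : induces_norm dot.
Variables (F : H -> H) (C Om : set H) (eta L : R).
Hypotheses (eta_gt0 : 0 < eta) (L_gt0 : 0 < L).
Hypothesis monoF : strongly_monotone dot F C eta.
Hypothesis lipF : Lipschitz_continuous F C L.
Hypothesis OmC : Om `<=` C.

Lemma VI_unique x x' : VI dot F Om x -> VI dot F Om x' -> x = x'.
Proof.
move=> [Ox xP] [Ox' x'P]; have := monoF (OmC Ox) (OmC Ox').
have := xP _ Ox'; have := x'P _ Ox.
rewrite !dotDl !dotDr !dotNl !dotNr => h1 h2 h3.
have xx0 : `|x - x'| ^+ 2 <= 0 by rewrite -(pmulr_rle0 _ eta_gt0); lra.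
apply/eqP; rewrite -subr_eq0 -normr_eq0 -sqrf_eq0.
by rewrite eq_le xx0 exprn_ge0.
Qed.

(* Solutions are the fixed points of the contraction [P (x - mu F x)], with [P]
   the projection onto [Om]. *)
Lemma VI_exists : closed Om -> convex_set Om -> Om !=set0 ->
  exists x, VI dot F Om x.
Proof.
move=> clOm cOm Om0.
have /choice[P /all_and2[PO PP]] :=
  fun x => exists_proj Hdot x clOm cOm Om0.
(* The first bound is the step restriction of [gradient_step_le]; the second keeps the contraction
   constant nonnegative. *)
pose mu := Num.min (eta / L ^+ 2) (1 / eta).
have mu0 : 0 < mu by rewrite lt_min !divr_gt0// exprn_gt0.
have muL : mu * L ^+ 2 <= eta.
  by rewrite -ler_pdivlMr ?exprn_gt0// ge_min lexx.
have mueta : mu * eta <= 1 by rewrite -ler_pdivlMr// ge_min lexx orbT.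
(* The two obtuse-angle inequalities say that P x - P y and (x - P x) - (y - P y) have a nonnegative
   inner product. *)
have Pnexp x y : `|P x - P y| ^+ 2 <= `|x - y| ^+ 2.
  have := PP x _ (PO y); have := PP y _ (PO x).
  have -> : x - y = (P x - P y) + ((x - P x) - (y - P y)).
    have -> : (x - P x) - (y - P y) = (x - y) - (P x - P y).
      by rewrite !opprB [P y - y]addrC addrACA (addrC (- P x)).
    by rewrite [RHS]addrC subrK.
  rewrite (norm_sqD Hdot (P x - P y)).
  have -> : dot (P x - P y) ((x - P x) - (y - P y)) =
      - dot (x - P x) (P y - P x) - dot (y - P y) (P x - P y).
    by rewrite -[P y - P x]opprB dotNr opprK dotC dotDl dotNl.
  have := exprn_ge0 2 (normr_ge0 ((x - P x) - (y - P y))).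
  by move=> *; lra.
pose T x := P (x - mu *: F x).
have TO : set_fun Om Om T by move=> x _; exact: PO.
(* As (1 - c / 2)^2 >= 1 - c with c = mu eta, this is a Lipschitz constant for the unsquared
   norms. *)
have q0 : 0 <= 1 - mu * eta / 2 by lra.
pose q := NngNum q0.
have [|p Op pT] := @banach_fixed_point _ _ _ (mkfun_fun TO) _ clOm Om0.
  exists q; split=> /=; first by rewrite ltrBlDr ltrDl divr_gt0// mulr_gt0.
  move=> [x y] [/= /OmC Cx /OmC Cy].
  rewrite -(@ler_pXn2r _ 2) ?nnegrE ?mulr_ge0//.
  apply: le_trans (Pnexp _ _) _.
  apply: le_trans
    (gradient_step_le Hdot monoF lipF L_gt0 Cx Cy (ltW mu0) muL) _.
  rewrite exprMn ler_wpM2r ?exprn_ge0//.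
  by have := exprn_ge0 2 (ltW (divr_gt0 (mulr_gt0 mu0 eta_gt0) (ltr0Sn R 1)));
    nra.
exists p; split=> // y Oy.
have := PP (p - mu *: F p) _ Oy; rewrite -[P _]/(T p).
have <- : p = T p by [].
by rewrite addrAC subrr add0r dotNl dotZl oppr_le0 pmulr_rge0.
Qed.

End VariationalInequality.

(** * Real recursions driven by a divergent series *)

Section Recursion.
Context {R : realType}.
Implicit Types (s al d D : nat -> R).

Lemma partial_sums_unbounded al M n1 :
  (forall n, 0 < al n) -> (\sum_(1 <= n <oo) (al n)%:E = +oo)%E ->
  exists n, (n1 <= n)%N /\ M < \sum_(1 <= i < n) al i.
Proof.
move=> al0 sumoo; apply: contrapT => /forallNP nbig.
suff : (\sum_(1 <= n <oo) (al n)%:E <= M%:E)%E by rewrite sumoo leye_eq.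
apply: lime_le.
  by apply: is_cvg_nneseries => n _ _; rewrite lee_fin ltW.
exists n1 => // n /= n1n; rewrite sumEFin lee_fin leNgt.
by apply/negP => Ms; exact: (nbig n).
Qed.

(** [d] stands for the forcing term and [D] for the residual. The last hypothesis asks for smallness
    of [d] only where [D] is small, in place of a limit superior condition. *)
Lemma recursion_cvg0 s al d D (eta K : R) (n0 : nat) :
  0 < eta -> (forall n, 0 <= s n) -> (forall n, 0 < al n) ->
  al n @[n --> \oo] --> (0 : R) ->
  (\sum_(1 <= n <oo) (al n)%:E = +oo)%E ->
  (forall n, 0 <= D n) -> (forall n, (n0 <= n)%N -> d n <= K) ->
  (forall n, (n0 <= n)%N ->
    s n.+1 <= (1 - al n * eta) * s n + al n * d n - D n) ->
  (forall e, 0 < e -> exists delta, 0 < delta /\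
    \forall n \near \oo, D n < delta -> d n < e) ->
  s n @[n --> \oo] --> (0 : R).
Proof.
move=> eta0 s0 al0 alcvg sumoo D0 dK srec dsmall.
have srec' e : 0 < e -> \forall n \near \oo,
    s n.+1 <= (1 - al n * eta) * s n + al n * eta * e.
  move=> e0; have [|delta [delta0 small]] := dsmall (eta * e).
    by rewrite mulr_gt0.
  have K0 : 0 < `|K| + 1 by rewrite ltr_wpDl.
  have dK0 : 0 < delta / (`|K| + 1) by rewrite divr_gt0.
  near=> n.
  have n0n : (n0 <= n)%N by near: n; exact: nbhs_infty_ge.
  (* Gives [al n * d n <= delta <= D n] when the residual is large, so that it cancels the
     forcing. *)
  have aln : al n * (`|K| + 1) <= delta.
    rewrite -ler_pdivlMr//; near: n.
    by have /cvgrPdistC_lt/(_ _ dK0) := alcvg; apply: filterS => n;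
      rewrite subr0 => /(le_lt_trans (ler_norm _))/ltW.
  have sn := srec n n0n; have an := ltW (al0 n).
  have ane : 0 <= al n * eta * e by rewrite !mulr_ge0// ltW.
  have [Dn|Dn] := ltP (D n) delta.
    have dn : d n < eta * e by move: Dn; near: n.
    by have := ler_wpM2l an (ltW dn); have := D0 n; lra.
  have := ler_wpM2l an (dK n n0n); have := ler_wpM2l an (ler_norm K); lra.
apply/cvgrPdistC_lt => e e0.
have e20 : 0 < e / 2 by rewrite divr_gt0.
have [n1 _ n1P] : \forall n \near \oo, al n * eta < 1 /\
    s n.+1 <= (1 - al n * eta) * s n + al n * eta * (e / 2).
  near=> n; split; last by near: n; exact: srec'.
  rewrite -ltr_pdivlMr//; near: n.
  have ieta : 0 < 1 / eta by rewrite divr_gt0.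
  by have /cvgrPdistC_lt/(_ _ ieta) := alcvg; apply: filterS => n;
    rewrite subr0 => /(le_lt_trans (ler_norm _)).
(* If [s] stayed at or above [e], the target e / 2 would make each step lose at least al eta e / 2,
   and divergence of the series would make [s] negative. *)
have [n2 [n12 sn2]] : exists n2, (n1 <= n2)%N /\ s n2 < e.
  apply: contrapT => /forallNP sbig.
  have se n : (n1 <= n)%N -> e <= s n.
    by move=> n1n; rewrite leNgt; apply/negP => sn; exact: (sbig n).
  pose S n := \sum_(1 <= i < n) al i.
  have descent n : (n1 <= n)%N ->
      S n.+1 * (eta * e / 2) + s n.+1 <= S n1.+1 * (eta * e / 2) + s n1.+1.
    elim: n => [|n IH]; first by rewrite leqn0 => /eqP ->.
    rewrite leq_eqVlt => /predU1P[->//|]; rewrite ltnS => n1n.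
    apply: le_trans (IH n1n); rewrite /S big_nat_recr//= -/(S _).
    have [_] := n1P n.+1 (leqW n1n).
    have := ler_wpM2l (ltW (mulr_gt0 (al0 n.+1) eta0)) (se _ (leqW n1n)).
    by rewrite -/(S n.+1); move=> *; lra.
  have [n [n1n]] := partial_sums_unbounded
    ((S n1.+1 * (eta * e / 2) + s n1.+1) / (eta * e / 2)) n1.+2 al0 sumoo.
  rewrite ltr_pdivrMr ?divr_gt0 ?mulr_gt0//; apply/negP; rewrite -leNgt.
  case: n n1n => // n; rewrite ltnS => /ltnW n1n.
  by apply: le_trans (descent _ n1n); rewrite lerDl.
(* Once below [e] the sequence stays there: the next term is bounded by a convex combination of
   [s n] and e / 2. *)
exists n2 => // n /=; elim: n => [|n IH].
  by rewrite leqn0 => /eqP n20; rewrite subr0 ger0_norm// -n20.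
rewrite leq_eqVlt => /predU1P[<-|]; first by rewrite subr0 ger0_norm.
rewrite ltnS !subr0 !ger0_norm// in IH * => n2n.
have sn := IH n2n; have [aln srn] := n1P n (leq_trans n12 n2n).
have := mulr_gt0 (al0 n) eta0; nra.
Unshelve. all: end_near. Qed.

End Recursion.

(** * The two proximal steps of the extragradient method *)

Section Extragradient.
Context {R : realType} {H : completeNormedModType R}.
Variable dot : {dot H for @idfun R}.
Hypothesis Hdot : induces_norm dot.
Variables (C : set H) (f : H -> H -> R) (c1 c2 rho : R).
Hypotheses (C_convex : convex_set C) (rho_ge0 : 0 <= rho).
Hypothesis f_Lipschitz : Lipschitz_type f C c1 c2.
Hypothesis f_convex : forall x, C x -> convex_function C (f x).
Variables x y z : H.
Hypothesis Cx : C x.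
Hypothesis y_argmin :
  argmin (fun v => rho * f x v + 1 / 2 * `|x - v| ^+ 2) C y.
Hypothesis z_argmin :
  argmin (fun v => rho * f y v + 1 / 2 * `|x - v| ^+ 2) C z.

(** Sum of the proximal inequalities for [z] at [v] and for [y] at [z] with the Lipschitz-type
    inequality at x, y, z. The point [v] stays free: a solution gives the descent estimate, an
    arbitrary point of [C] identifies weak limits. *)
Lemma extragradient_ge v : C v ->
  dot (x - z) (v - z) + dot (x - y) (z - y)
  - rho * c1 * `|x - y| ^+ 2 - rho * c2 * `|y - z| ^+ 2 <= rho * f y v.
Proof.
move=> Cv; have [Cy Cz] := (y_argmin.1, z_argmin.1).
have hz := argmin_prox Hdot C_convex (f_convex Cy) rho_ge0 z_argmin Cv.
have hy := argmin_prox Hdot C_convex (f_convex Cx) rho_ge0 y_argmin Cz.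
by have := ler_wpM2l rho_ge0 (f_Lipschitz Cx Cy Cz); lra.
Qed.

(** Take [v = p]: pseudomonotonicity gives [f y p <= 0], and polarization turns the inner products
    into squared norms. *)
Lemma extragradient_le p : pseudomonotone f C -> EP f C p ->
  `|z - p| ^+ 2 <= `|x - p| ^+ 2
    - (1 - 2 * (rho * c1)) * `|x - y| ^+ 2
    - (1 - 2 * (rho * c2)) * `|y - z| ^+ 2.
Proof.
move=> pmf [Cp fp]; have Cy := y_argmin.1.
have := extragradient_ge Cp.
have := mulr_ge0_le0 rho_ge0 (pmf _ _ Cp Cy (fp _ Cy)).
have -> : x - p = (x - z) - (p - z) by rewrite opprB addrA subrK.
have -> : y - z = - (z - y) by rewrite opprB.
rewrite (norm_sqB Hdot (x - z)) normrN [`|z - p|]distrC.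
have -> : x - z = (x - y) - (z - y) by rewrite opprB addrA subrK.
by rewrite (norm_sqB Hdot (x - y)) => *; lra.
Qed.

End Extragradient.

(** * Null sequences and subsequences *)

Section ZeroLimits.
Context {R : realType} {H : completeNormedModType R}.
Variable dot : {dot H for @idfun R}.
Hypothesis Hdot : induces_norm dot.
Implicit Types (v w : nat -> H) (D : nat -> R).

Lemma sq_le_cvg0 v D (c : R) : 0 < c ->
  (forall k, c * `|v k| ^+ 2 <= D k) ->
  D k @[k --> \oo] --> (0 : R) -> v k @[k --> \oo] --> (0 : H).
Proof.
move=> c0 vD D0; apply/cvgr0Pnorm_lt => e e0.
have ce0 : 0 < c * e ^+ 2 by rewrite mulr_gt0 ?exprn_gt0.
have /cvgrPdistC_lt/(_ _ ce0) := D0; apply: filterS => k.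
rewrite subr0 => /(le_lt_trans (ler_norm _))/(le_lt_trans (vD k)).
by rewrite ltr_pM2l// ltr_pXn2r ?nnegrE// ltW.
Qed.

Lemma norm_le_cvg0 v D : (forall k, `|v k| <= D k) ->
  D k @[k --> \oo] --> (0 : R) -> v k @[k --> \oo] --> (0 : H).
Proof.
move=> vD D0; apply: norm_cvg0; apply: (squeeze_cvgr _ (cvg_cst 0) D0).
by apply: nearW => k; rewrite normr_ge0 vD.
Qed.

Lemma dot_cvg0 v w B : (forall k, `|w k| <= B) ->
  v k @[k --> \oo] --> (0 : H) -> dot (v k) (w k) @[k --> \oo] --> (0 : R).
Proof.
move=> wB v0; apply: norm_cvg0.
have vB0 : `|v k| * B @[k --> \oo] --> (0 : R).
  rewrite -[X in _ --> X](mul0r B) -(@normr0 _ H).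
  by apply: cvgM; [exact: cvg_norm|exact: cvg_cst].
apply: (squeeze_cvgr _ (cvg_cst 0) vB0); apply: nearW => k.
by rewrite normr_ge0 (le_trans (abs_dot_le_norm Hdot _ _))// ler_wpM2l.
Qed.

Lemma cvg_ge_comp (h : nat -> R) (m : nat -> nat) (l : R) :
  (forall k, (k <= m k)%N) -> h n @[n --> \oo] --> l ->
  h (m k) @[k --> \oo] --> l.
Proof.
move=> km hl; apply: (cvg_comp _ _ _ hl) => A [n _ nA].
by exists n => // k nk; apply: nA => /=; exact: leq_trans (km k).
Qed.

End ZeroLimits.

(** * The iteration: boundedness, weak cluster points and strong convergence *)

Section Algorithm.
Context {R : realType} {H : completeNormedModType R}.
Variable dot : {dot H for @idfun R}.
Hypothesis Hdot : induces_norm dot.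
Variables (C : set H) (N M : nat) (f : 'I_N -> H -> H -> R).
Variables (S : 'I_M -> H -> H) (F : H -> H) (c1 c2 beta eta L : R).
Hypotheses (C_closed : closed C) (C_convex : convex_set C).
Hypothesis A1 :
  forall i, pseudomonotone (f i) C /\ (forall x, C x -> f i x x = 0).
Hypotheses (c1_gt0 : 0 < c1) (c2_gt0 : 0 < c2).
Hypothesis A2 : forall i, Lipschitz_type (f i) C c1 c2.
Hypothesis A3 : forall i, weakly_usc_left (f i) C.
Hypothesis A4 : forall i x, C x -> convex_function C (f i x).
Hypothesis S_into : forall j x, C x -> C (S j x).
Hypothesis beta_ge0 : 0 <= beta.
Hypothesis S_demicontractive : forall j, demicontractive (S j) C beta.
Hypothesis S_demiclosed : forall j, demiclosed_at_zero (S j) C.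
Hypotheses (eta_gt0 : 0 < eta) (L_gt0 : 0 < L).
Hypothesis F_monotone : strongly_monotone dot F C eta.
Hypothesis F_Lipschitz : Lipschitz_continuous F C L.

Definition solution_set := (\bigcap_i EP (f i) C) `&` (\bigcap_j Fix (S j) C).
Local Notation Omega := solution_set.

Variables (rho a : R) (alpha : nat -> R) (betan : nat -> 'I_M -> R).
Hypothesis rho_itv : 0 < rho < Num.min (1 / (2 * c1)) (1 / (2 * c2)).
Hypothesis alpha_gt0 : forall n, 0 < alpha n.
Hypothesis alpha_cvg : alpha n @[n --> \oo] --> (0 : R).
Hypothesis alpha_sum : (\sum_(1 <= n <oo) (alpha n)%:E = +oo)%E.
Hypothesis a_gt0 : 0 < a.
Hypothesis betan_itv : forall n j, a <= betan n j < (1 - beta) / 2.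
Variables (x : nat -> H) (y z : nat -> 'I_N -> H) (zbar t : nat -> H).
Variables (u : nat -> 'I_M -> H) (imax : nat -> 'I_N) (jmax : nat -> 'I_M).
Hypothesis x0_in : C (x 0%N).
Hypothesis yE : forall n i,
  argmin (fun v => rho * f i (x n) v + 1 / 2 * `|x n - v| ^+ 2) C (y n i).
Hypothesis zE : forall n i,
  argmin (fun v => rho * f i (y n i) v + 1 / 2 * `|x n - v| ^+ 2) C (z n i).
Hypothesis imaxP : forall n i, `|z n i - x n| <= `|z n (imax n) - x n|.
Hypothesis zbarE : forall n, zbar n = z n (imax n).
Hypothesis tE : forall n, t n = zbar n - alpha n *: F (zbar n).
Hypothesis t_in : forall n, C (t n).
Hypothesis uE : forall n j,
  u n j = (1 - betan n j) *: t n + betan n j *: S j (t n).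
Hypothesis jmaxP : forall n j, `|u n j - t n| <= `|u n (jmax n) - t n|.
Hypothesis xE : forall n, x n.+1 = u n (jmax n).

Local Notation k1 := (1 - 2 * (rho * c1)).
Local Notation k2 := (1 - 2 * (rho * c2)).

Lemma rho_gt0 : 0 < rho. Proof. by case/andP: rho_itv. Qed.

Lemma k1_gt0 : 0 < k1.
Proof.
move: rho_itv; rewrite lt_min => /and3P[_ + _].
by rewrite ltr_pdivlMr ?mulr_gt0// => ?; lra.
Qed.

Lemma k2_gt0 : 0 < k2.
Proof.
move: rho_itv; rewrite lt_min => /and3P[_ _].
by rewrite ltr_pdivlMr ?mulr_gt0// => ?; lra.
Qed.

Lemma betan_gt0 n j : 0 < betan n j.
Proof. by case/andP: (betan_itv n j) => /(lt_le_trans a_gt0). Qed.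

Lemma x_in n : C (x n).
Proof.
case: n => // n; rewrite xE uE addrC; apply: convex_setE => //.
  exact: S_into.
have := beta_ge0; have := betan_gt0 n (jmax n).
have /andP[_] := betan_itv n (jmax n).
by move=> *; apply/andP; split; lra.
Qed.

Lemma solution_set_closed : closed Omega.
Proof.
apply: closedI; apply: closed_bigI => i _; first exact: EP_closed.
exact: Fix_closed.
Qed.

Lemma solution_set_convex : convex_set Omega.
Proof.
move=> v w r /set_mem[vEP vFix] /set_mem[wEP wFix]; apply/mem_set.
split=> i _.
- have [pm f0] := A1 i.
  apply: set_mem (EP_convex C_convex pm f0 (A3 i) (A4 i) _ _ _).
    exact: mem_set (vEP i I).
  exact: mem_set (wEP i I).
- have cFix := Fix_convex Hdot C_convex (S_demicontractive i).
  exact: set_mem (cFix _ _ r (mem_set (vFix i I)) (mem_set (wFix i I))).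
Qed.

Lemma z_le p n i : Omega p ->
  `|z n i - p| ^+ 2 <= `|x n - p| ^+ 2
    - k1 * `|x n - y n i| ^+ 2 - k2 * `|y n i - z n i| ^+ 2.
Proof.
move=> [pEP _]; apply: (extragradient_le Hdot C_convex (ltW rho_gt0) (A2 i)
  (A4 i) (x_in n) (yE n i) (zE n i) (A1 i).1); exact: pEP.
Qed.

Lemma zbar_in n : C (zbar n).
Proof. by rewrite zbarE; exact: (zE n _).1. Qed.

(* Since [2 betan <= 1 - beta], the weight [b (1 - beta - b)] of the relaxation
   estimate is at least [b ^ 2]. *)
Lemma next_le p n : Omega p ->
  `|x n.+1 - p| ^+ 2 <= `|t n - p| ^+ 2 - `|x n.+1 - t n| ^+ 2.
Proof.
move=> [_ pFix]; rewrite xE; set j := jmax n.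
have Fp : Fix (S j) C p by exact: pFix.
have b0 := betan_gt0 n j; have /andP[_ b2] := betan_itv n j.
have := relaxation_le Hdot (S_demicontractive j) Fp (t_in n) (ltW b0).
rewrite -uE => /le_trans; apply.
have -> : u n j - t n = betan n j *: (S j (t n) - t n).
  by rewrite uE scalerBl scale1r scalerBr addrAC [t n - _]addrC addrK addrC.
rewrite normrZ exprMn real_normK ?num_real// [`|S _ _ - _|]distrC lerD2l lerN2.
by rewrite ler_wpM2r ?exprn_ge0//; nra.
Qed.

(** Maximality of [jmax n] lets one step length control every [j], and the lower bound [a] makes the
    control uniform in [n]. *)
Lemma relaxation_gap_le n j :
  a ^+ 2 * `|S j (t n) - t n| ^+ 2 <= `|x n.+1 - t n| ^+ 2.
Proof.
have /andP[ab _] := betan_itv n j; have b0 := betan_gt0 n j.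
have ut : `|u n j - t n| = betan n j * `|S j (t n) - t n|.
  rewrite uE scalerBl scale1r addrAC [t n - _]addrC addrK addrC -scalerBr.
  by rewrite normrZ gtr0_norm.
rewrite -exprMn xE lerXn2r ?nnegrE ?mulr_ge0 ?(ltW a_gt0)//.
by apply: le_trans (jmaxP n j); rewrite ut ler_wpM2r.
Qed.

(** The first bound serves the gradient step; the second keeps 1 - alpha n eta at least 1/2, the
    weight used in [residual]. *)
Lemma small_step : exists n0, forall n, (n0 <= n)%N ->
  alpha n * L ^+ 2 <= eta /\ alpha n * eta <= 1 / 2.
Proof.
pose e := Num.min (eta / L ^+ 2) (1 / 2 / eta).
have e0 : 0 < e by rewrite lt_min !divr_gt0// exprn_gt0.
have /cvgrPdistC_lt/(_ _ e0)[n0 _ n0P] := alpha_cvg.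
exists n0 => n /n0P; rewrite subr0 gtr0_norm// lt_min => /andP[/ltW h1 /ltW h2].
by split; rewrite -ler_pdivlMr// exprn_gt0.
Qed.

(** The difference of the gradient steps at [zbar n] and [p] is [t n - p] plus [alpha n *: F p];
    expand its square and drop the square of the last term. *)
Lemma t_le p n : Omega p -> alpha n * L ^+ 2 <= eta ->
  `|t n - p| ^+ 2 <= (1 - alpha n * eta) * `|zbar n - p| ^+ 2
    + alpha n * (2 * dot (F p) (p - t n)).
Proof.
(* Membership of [p] in [C] is read off one equilibrium set; [imax 0] supplies its index. *)
move=> [pEP _] aL; have Cp : C p by exact: (pEP (imax 0%N) I).1.
have al0 := ltW (alpha_gt0 n).
have := gradient_step_le Hdot F_monotone F_Lipschitz L_gt0
  (zbar_in n) Cp al0 aL.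
have -> : zbar n - alpha n *: F (zbar n) - (p - alpha n *: F p) =
    (t n - p) - (- (alpha n *: F p)) by rewrite -tE !opprD !opprK addrA.
rewrite (norm_sqB Hdot (t n - p)) normrN dotNr dotZr.
rewrite -[p - t n]opprB dotNr [dot (F p) _]dotC.
by have := exprn_ge0 2 (normr_ge0 (alpha n *: F p)); move=> *; lra.
Qed.

Lemma iterates_bounded p n0 : Omega p ->
  (forall n, (n0 <= n)%N ->
    alpha n * L ^+ 2 <= eta /\ alpha n * eta <= 1 / 2) ->
  exists K, forall n, (n0 <= n)%N -> `|x n - p| <= K /\ `|t n - p| <= K.
Proof.
move=> Op n0P.
(* [K] bounds squared distances: it covers the starting point, and its second term absorbs the
   forcing through [FK]. *)
pose K := Num.max (`|x n0 - p| ^+ 2) (4 / eta ^+ 2 * `|F p| ^+ 2).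
have K0 : 0 <= K by rewrite le_max exprn_ge0.
have FK : 2 / eta * `|F p| ^+ 2 <= eta / 2 * K.
  have -> : 2 / eta * `|F p| ^+ 2 = eta / 2 * (4 / eta ^+ 2 * `|F p| ^+ 2).
    by field; rewrite gt_eqF.
  by rewrite ler_wpM2l ?divr_ge0 ?(ltW eta_gt0)// le_max lexx orbT.
have tK n : (n0 <= n)%N -> `|x n - p| ^+ 2 <= K -> `|t n - p| ^+ 2 <= K.
  move=> n0n xK; have [aL ae] := n0P n n0n.
  have ae0 := mulr_gt0 (alpha_gt0 n) eta_gt0.
  have tl := t_le Op aL.
  have zK : `|zbar n - p| ^+ 2 <= K.
    apply: le_trans xK; rewrite zbarE; apply: le_trans (z_le n (imax n) Op) _.
    have := mulr_ge0 (ltW k1_gt0)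
      (exprn_ge0 2 (normr_ge0 (x n - y n (imax n)))).
    have := mulr_ge0 (ltW k2_gt0)
      (exprn_ge0 2 (normr_ge0 (y n (imax n) - z n (imax n)))).
    by move=> *; lra.
  (* With the weight 2 / eta and c = alpha n eta, Young's inequality leads to (1 - c / 2) |t n -
     p|^2 <= (1 - c) K + (c / 2) K. *)
  have eta20 : 0 < 2 / eta by rewrite divr_gt0.
  have := dot_le_sq Hdot (F p) (p - t n) eta20.
  rewrite invf_div [`|p - t n|]distrC => dle.
  have := ler_wpM2l (ltW (alpha_gt0 n)) (le_trans dle (lerD FK (lexx _))).
  have zK' : (1 - alpha n * eta) * `|zbar n - p| ^+ 2 <=
      (1 - alpha n * eta) * K.
    by rewrite ler_wpM2l//; lra.
  move=> h; rewrite -(@ler_pM2l _ (1 - alpha n * eta / 2)); last by lra.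
  by lra.
have xK n : (n0 <= n)%N -> `|x n - p| ^+ 2 <= K.
  elim: n => [|n IH]; first by rewrite leqn0 /K => /eqP ->; rewrite le_max lexx.
  rewrite leq_eqVlt => /predU1P[<-|]; first by rewrite le_max lexx.
  rewrite ltnS => n0n; apply: le_trans (next_le n Op) _.
  by have := tK n n0n (IH n0n); have := exprn_ge0 2 (normr_ge0 (x n.+1 - t n));
    lra.
exists (Num.sqrt K) => n n0n.
have sq v : `|v| ^+ 2 <= K -> `|v| <= Num.sqrt K :> R.
  by move=> vK; rewrite -[`|v|]ger0_norm// -sqrtr_sqr ler_sqrt.
by split; apply: sq; [exact: xK|apply: tK => //; exact: xK].
Qed.

Definition residual n := 1 / 2 * (k1 * `|x n - y n (imax n)| ^+ 2
    + k2 * `|y n (imax n) - z n (imax n)| ^+ 2) + `|x n.+1 - t n| ^+ 2.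

Lemma next_sub_t_le n : `|x n.+1 - t n| ^+ 2 <= residual n.
Proof.
rewrite lerDr mulr_ge0// addr_ge0//.
  by rewrite mulr_ge0 ?exprn_ge0// ltW// k1_gt0.
by rewrite mulr_ge0 ?exprn_ge0// ltW// k2_gt0.
Qed.

Lemma x_sub_y_le n : k1 / 2 * `|x n - y n (imax n)| ^+ 2 <= residual n.
Proof.
have := mulr_ge0 (ltW k2_gt0)
  (exprn_ge0 2 (normr_ge0 (y n (imax n) - z n (imax n)))).
have := exprn_ge0 2 (normr_ge0 (x n.+1 - t n)); rewrite /residual.
by move=> *; lra.
Qed.

Lemma y_sub_z_le n : k2 / 2 * `|y n (imax n) - z n (imax n)| ^+ 2 <= residual n.
Proof.
have := mulr_ge0 (ltW k1_gt0) (exprn_ge0 2 (normr_ge0 (x n - y n (imax n)))).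
have := exprn_ge0 2 (normr_ge0 (x n.+1 - t n)); rewrite /residual.
by move=> *; lra.
Qed.

Lemma residual_ge0 n : 0 <= residual n.
Proof. by apply: le_trans (next_sub_t_le n); exact: exprn_ge0. Qed.

Lemma error_recursion p n : Omega p ->
  alpha n * L ^+ 2 <= eta -> alpha n * eta <= 1 / 2 ->
  `|x n.+1 - p| ^+ 2 <= (1 - alpha n * eta) * `|x n - p| ^+ 2
    + alpha n * (2 * dot (F p) (p - t n)) - residual n.
Proof.
move=> Op aL ae; have := next_le n Op; have := t_le Op aL.
have ae1 : 0 <= 1 - alpha n * eta by lra.
have := ler_wpM2l ae1 (z_le n (imax n) Op); rewrite /residual -zbarE.
have := mulr_ge0 (ltW k1_gt0) (exprn_ge0 2 (normr_ge0 (x n - y n (imax n)))).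
have := mulr_ge0 (ltW k2_gt0) (exprn_ge0 2 (normr_ge0 (y n (imax n) - zbar n))).
have ae2 : 0 <= 1 / 2 - alpha n * eta by lra.
by move=> /(mulr_ge0 ae2) h1 /(mulr_ge0 ae2) h2 *; lra.
Qed.

(** A vanishing residual controls the selected indices directly, and maximality extends this to all
    [i] and [j]. Demiclosedness then handles the fixed points, and the limit of [extragradient_ge]
    the equilibria. *)
Lemma weak_cluster_solution p q n0 (m : nat -> nat) : Omega p ->
  (forall n, (n0 <= n)%N ->
    alpha n * L ^+ 2 <= eta /\ alpha n * eta <= 1 / 2) ->
  (forall k, (k <= m k)%N) -> (forall k, (n0 <= m k)%N) ->
  residual (m k) @[k --> \oo] --> (0 : R) ->
  weak_cvg (fun k => x (m k)) q ->
  Omega q /\ weak_cvg (fun k => t (m k)) q.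
Proof.
move=> Op n0P km n0m D0 xq.
have [K KP] := iterates_bounded Op n0P.
have xK k : `|x (m k) - p| <= K by exact: (KP _ (n0m k)).1.
have K0 : 0 <= K by apply: le_trans (xK 0%N).
have zK k i : `|z (m k) i - p| <= K.
  apply: le_trans (xK k).
  rewrite -(@ler_pXn2r _ 2) ?nnegrE//; apply: le_trans (z_le (m k) i Op) _.
  have := mulr_ge0 (ltW k1_gt0)
    (exprn_ge0 2 (normr_ge0 (x (m k) - y (m k) i))).
  have := mulr_ge0 (ltW k2_gt0)
    (exprn_ge0 2 (normr_ge0 (y (m k) i - z (m k) i))).
  by move=> *; lra.
have zbx0 : z (m k) (imax (m k)) - x (m k) @[k --> \oo] --> (0 : H).
  have xy0 : x (m k) - y (m k) (imax (m k)) @[k --> \oo] --> (0 : H).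
    apply: (sq_le_cvg0 _ (fun k => x_sub_y_le (m k)) D0).
    by rewrite divr_gt0 ?k1_gt0.
  have yz0 :
      y (m k) (imax (m k)) - z (m k) (imax (m k)) @[k --> \oo] --> (0 : H).
    apply: (sq_le_cvg0 _ (fun k => y_sub_z_le (m k)) D0).
    by rewrite divr_gt0 ?k2_gt0.
  rewrite -[X in _ --> X]oppr0 -[X in _ --> - X]addr0.
  have -> : (fun k => z (m k) (imax (m k)) - x (m k)) =
      (fun k => - ((x (m k) - y (m k) (imax (m k))) +
                   (y (m k) (imax (m k)) - z (m k) (imax (m k))))).
    by apply/funext => k; rewrite subrKA opprB.
  by apply: cvgN; exact: cvgD.
have zx0 i : z (m k) i - x (m k) @[k --> \oo] --> (0 : H).
  apply: (norm_le_cvg0 (D := fun k => `|z (m k) (imax (m k)) - x (m k)|)).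
    by move=> k; exact: imaxP.
  by rewrite -(@normr0 _ H); exact: cvg_norm.
(* By [z_le], k1 |x - y|^2 <= |x - p|^2 - |z - p|^2, which factors and is at most |z - x| 2 K. *)
have xy0 i : x (m k) - y (m k) i @[k --> \oo] --> (0 : H).
  apply: (sq_le_cvg0 (c := k1)
    (D := fun k => `|z (m k) i - x (m k)| * (2 * K))).
  - exact: k1_gt0.
  - move=> k; have := z_le (m k) i Op.
    have := mulr_ge0 (ltW k2_gt0)
      (exprn_ge0 2 (normr_ge0 (y (m k) i - z (m k) i))).
    have tri : `|x (m k) - p| <= `|z (m k) i - x (m k)| + `|z (m k) i - p|.
      by rewrite [`|z (m k) i - x (m k)|]distrC; exact: ler_distD.
    have := xK k; have := zK k i.
    have := normr_ge0 (z (m k) i - x (m k)); have := normr_ge0 (x (m k) - p).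
    have := normr_ge0 (z (m k) i - p).
    move: tri; move: `|x _ - p| `|z _ _ - p| `|z _ _ - x _| => A B E *.
    have : (A - B) * (A + B) <= E * (2 * K).
      by apply: le_trans (_ : E * (A + B) <= _);
        [rewrite ler_wpM2r|rewrite ler_wpM2l]; lra.
    by lra.
  - rewrite -[X in _ --> X](mul0r (2 * K)) -(@normr0 _ H).
    by apply: cvgM; [apply: cvg_norm; exact: zx0|exact: cvg_cst].
have yq i : weak_cvg (fun k => y (m k) i) q.
  apply: (weak_cvg_add xq); rewrite -[X in _ --> X]oppr0.
  by under eq_fun do rewrite -opprB; exact: cvgN.
have tq : weak_cvg (fun k => t (m k)) q.
  apply: (weak_cvg_add xq).
  have -> : (fun k => t (m k) - x (m k)) =
      (fun k => (z (m k) (imax (m k)) - x (m k)) -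
        alpha (m k) *: F (zbar (m k))).
    by apply/funext => k; rewrite tE addrAC zbarE.
  rewrite -[X in _ --> X]subr0; apply: cvgB => //.
  apply: (norm_le_cvg0 (D := fun k => alpha (m k) * (L * K + `|F p|))).
    move=> k; rewrite normrZ gtr0_norm// ler_pM2l//.
    rewrite -[F _](subrK (F p)) (le_trans (ler_normD _ _))// lerD2r.
    have Cp : C p by exact: (Op.1 (imax 0%N) I).1.
    apply: le_trans (F_Lipschitz (zbar_in _) Cp) _.
    by rewrite ler_pM2l// zbarE.
  rewrite -[X in _ --> X](mul0r (L * K + `|F p|)).
  by apply: cvgM; [exact: cvg_ge_comp km alpha_cvg|exact: cvg_cst].
split=> //; split=> [i|j] _; last first.
  split; first exact: weakly_closed_convex tq.
  apply: (S_demiclosed (fun k => t_in (m k)) tq).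
  rewrite -(@normr0 _ H); apply: cvg_norm.
  apply: (@sq_le_cvg0 _ _ _ _ (a ^+ 2) _ _ D0); first by rewrite exprn_gt0.
  by move=> k; exact: le_trans (relaxation_gap_le _ _) (next_sub_t_le _).
split.
  exact: (weakly_closed_convex Hdot C_closed C_convex (fun k => x_in (m k)) xq).
move=> v Cv.
(* The lower bound of [extragradient_ge] for [f i (y (m k) i) v]; every term contains a null
   sequence. *)
pose e k := rho^-1 * (dot (x (m k) - z (m k) i) (v - z (m k) i)
  + dot (x (m k) - y (m k) i) (z (m k) i - y (m k) i)
  - rho * c1 * `|x (m k) - y (m k) i| ^+ 2
  - rho * c2 * `|y (m k) i - z (m k) i| ^+ 2).
apply: (weakly_usc_ge0 (A3 i) Cv (fun k => (yE (m k) i).1) (yq i) (e := e)).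
  have xz0 : x (m k) - z (m k) i @[k --> \oo] --> (0 : H).
    rewrite -[X in _ --> X]oppr0.
    by under eq_fun do rewrite -opprB; apply: cvgN; exact: zx0.
  have yz0 : y (m k) i - z (m k) i @[k --> \oo] --> (0 : H).
    have -> : (fun k => y (m k) i - z (m k) i) =
        (fun k => (x (m k) - z (m k) i) - (x (m k) - y (m k) i)).
      by apply/funext => k; rewrite opprB [RHS]addrC subrKA.
    by rewrite -[X in _ --> X]subr0; apply: cvgB => //; exact: xy0.
  rewrite -[X in _ --> X](mulr0 rho^-1).
  apply: cvgM; first exact: cvg_cst.
  have sq0 (v' : nat -> H) : v' k @[k --> \oo] --> (0 : H) ->
      forall c : R, c * `|v' k| ^+ 2 @[k --> \oo] --> (0 : R).
    move=> v'0 c; rewrite -[X in _ --> X](mulr0 c).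
    apply: cvgM; first exact: cvg_cst.
    rewrite -[X in _ --> X](mulr0 0); under eq_fun do rewrite expr2.
    by rewrite -(@normr0 _ H); apply: cvgM; exact: cvg_norm.
  rewrite -[X in _ --> X]subr0 -[X in _ --> X - _]subr0.
  rewrite -[X in _ --> X - _ - _]addr0.
  apply: cvgB; last exact: sq0.
  apply: cvgB; last exact: sq0.
  apply: cvgD.
    apply: (dot_cvg0 Hdot (B := `|v - p| + K)) => // k.
    by apply: le_trans (ler_distD p _ _) _; rewrite lerD2l distrC.
  have [B yzB] : exists B, forall k, `|z (m k) i - y (m k) i| <= B.
    have [B [_ BP]] := cvg_seq_bounded (cvgP _ yz0).
    by exists (B + 1) => k; rewrite distrC; apply: BP => //; rewrite ltrDl.
  apply: (dot_cvg0 Hdot (B := B)); [exact: yzB|exact: xy0].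
move=> k; rewrite /e ler_pdivrMl ?rho_gt0//.
exact: (extragradient_ge Hdot C_convex (ltW rho_gt0) (A2 i)
  (A4 i) (x_in _) (yE _ i) (zE _ i) Cv).
Qed.

Lemma algorithm_cvg p : VI dot F Omega p -> x n @[n --> \oo] --> p.
Proof.
move=> [Op pP]; have [n0 n0P] := small_step.
have [K KP] := iterates_bounded Op n0P.
suff s0 : `|x n - p| ^+ 2 @[n --> \oo] --> (0 : R).
  apply/subr_cvg0; apply: (sq_le_cvg0 (c := 1) _ _ s0) => // k.
  by rewrite mul1r.
apply: (@recursion_cvg0 _ _ alpha (fun n => 2 * dot (F p) (p - t n)) residual
  eta (2 * (`|F p| * K)) n0) => //.
- exact: residual_ge0.
- move=> n n0n; rewrite ler_pM2l//.
  apply: le_trans (dot_le_norm Hdot _ _) _.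
  by rewrite ler_wpM2l// distrC; exact: (KP n n0n).2.
- by move=> n n0n; have [aL ae] := n0P n n0n; exact: error_recursion.
(* If no delta works for [e], each 1 / (k + 1) fails arbitrarily far out. This selects indices whose
   residuals tend to 0 while the forcing stays at least [e]. *)
move=> e e0; apply: contrapT => /forallNP noe.
have /choice[h hP] : forall k, exists n,
    [/\ (n0 + k <= n)%N, residual n < k.+1%:R^-1 &
      e <= 2 * dot (F p) (p - t n)].
  move=> k; apply: contrapT => /forallNP noh.
  apply: (noe k.+1%:R^-1); split; first by rewrite invr_gt0.
  exists (n0 + k)%N => // n /= kn Dn; rewrite ltNge; apply/negP => en.
  by apply: (noh n); split.
have n0h k : (n0 <= h k)%N by case: (hP k) => /(leq_trans (leq_addr _ _)).
have kh k : (k <= h k)%N by case: (hP k) => /(leq_trans (leq_addl _ _)).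
have [|g [q [kg xq]]] := bounded_weak_cvg_subseq Hdot (u := fun k => x (h k))
    (B := K + `|p|).
  move=> k; rewrite -[x _](subrK p) (le_trans (ler_normD _ _))// lerD2r.
  exact: (KP _ (n0h k)).1.
have D0 : residual (h (g k)) @[k --> \oo] --> (0 : R).
  apply: (@squeeze_cvgr _ _ _ _ (fun=> 0) harmonic); last exact: cvg_harmonic.
    apply: nearW => k; rewrite residual_ge0 /=.
    have [_ /ltW Dk _] := hP (g k); apply: le_trans Dk _.
    by rewrite lef_pV2 ?posrE// ler_nat ltnS kg.
  exact: cvg_cst.
have [Oq tq] := weak_cluster_solution (m := fun k => h (g k)) Op n0P
  (fun k => leq_trans (kg k) (kh (g k))) (fun k => n0h (g k)) D0 xq.
have := pP _ Oq; apply/negP; rewrite -ltNge.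
have /= tp := weak_cvg_dot (w := F p) Hdot tq.
(* The weak limit keeps <F p, q - p> <= -e / 2, against the variational inequality at [q]. *)
have tpe : dot (F p) q <= dot (F p) p - e / 2.
  apply: (cvgr_to_le tp); apply: nearW => k.
  have [_ _] := hP (g k); rewrite dotDr dotNr => *; lra.
rewrite dotDr dotNr; move: e0 => *; lra.
Qed.
End Algorithm.

Theorem theorem1 (R : realType) (H : completeNormedModType R)
  (dot : {dot H for @idfun R}) (Hdot : induces_norm dot)
  (C : set H) (C_nonempty : C !=set0) (C_closed : closed C)
  (C_convex : convex_set C)
  (N M : nat) (f : 'I_N -> H -> H -> R) (S : 'I_M -> H -> H) (F : H -> H)
  (c1 c2 beta eta L : R)
  (A1 : forall i, pseudomonotone (f i) C /\ (forall x, C x -> f i x x = 0))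
  (c1_gt0 : 0 < c1) (c2_gt0 : 0 < c2)
  (A2 : forall i, Lipschitz_type (f i) C c1 c2)
  (A3 : forall i, weakly_usc_left (f i) C)
  (A4 : forall i x, C x ->
     convex_function C (f i x) /\ subdifferentiable dot (f i x) C)
  (S_into : forall j x, C x -> C (S j x))
  (beta_itv : 0 <= beta < 1)
  (S_demicontractive : forall j, demicontractive (S j) C beta)
  (S_demiclosed : forall j, demiclosed_at_zero (S j) C)
  (eta_gt0 : 0 < eta) (L_gt0 : 0 < L)
  (F_monotone : strongly_monotone dot F C eta)
  (F_Lipschitz : Lipschitz_continuous F C L)
  (Omega : set H)
  (OmegaE : Omega = (\bigcap_i EP (f i) C) `&` (\bigcap_j Fix (S j) C))
  (Omega_nonempty : Omega !=set0)
  (rho a : R) (alpha : nat -> R) (betan : nat -> 'I_M -> R)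
  (rho_itv : 0 < rho < Num.min (1 / (2 * c1)) (1 / (2 * c2)))
  (alpha_gt0 : forall n, 0 < alpha n)
  (alpha_cvg : alpha n @[n --> \oo] --> (0 : R))
  (alpha_sum : (\sum_(1 <= n <oo) (alpha n)%:E = +oo)%E)
  (a_gt0 : 0 < a)
  (betan_itv : forall n j, a <= betan n j < (1 - beta) / 2)
  (x : nat -> H) (y z : nat -> 'I_N -> H) (zbar t : nat -> H)
  (u : nat -> 'I_M -> H) (imax : nat -> 'I_N) (jmax : nat -> 'I_M)
  (x0_in : C (x 0%N))
  (yE : forall n i,
     argmin (fun v => rho * f i (x n) v + 1 / 2 * `|x n - v| ^+ 2) C (y n i))
  (zE : forall n i,
     argmin (fun v => rho * f i (y n i) v + 1 / 2 * `|x n - v| ^+ 2) C (z n i))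
  (imaxP : forall n i, `|z n i - x n| <= `|z n (imax n) - x n|)
  (zbarE : forall n, zbar n = z n (imax n))
  (tE : forall n, t n = zbar n - alpha n *: F (zbar n))
  (* S j is only defined on C, so S j (t n) presupposes C (t n) *)
  (t_in : forall n, C (t n))
  (uE : forall n j, u n j = (1 - betan n j) *: t n + betan n j *: S j (t n))
  (jmaxP : forall n j, `|u n j - t n| <= `|u n (jmax n) - t n|)
  (xE : forall n, x n.+1 = u n (jmax n)) :
  exists xs : H, unique (VI dot F Omega) xs /\ x n @[n --> \oo] --> xs.
Proof.
have A4' i v : C v -> convex_function C (f i v) by move=> /(A4 i)[].
have [beta_ge0 _] := andP beta_itv.
have OmC : Omega `<=` C.
  by rewrite OmegaE => v [vEP _]; exact: (vEP (imax 0%N) I).1.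
have OmE : Omega = solution_set C f S by [].
have clOm : closed Omega by rewrite OmE; exact: solution_set_closed.
have cOm : convex_set Omega.
  rewrite OmE.
  exact: (solution_set_convex Hdot C_convex A1 A3 A4' S_demicontractive).
have [xs xsVI] := VI_exists Hdot eta_gt0 L_gt0 F_monotone F_Lipschitz OmC
  clOm cOm Omega_nonempty.
exists xs; split.
  by split=> // x' x'VI; exact: VI_unique eta_gt0 F_monotone OmC _ _ xsVI x'VI.
rewrite OmE in xsVI.
exact: (algorithm_cvg Hdot C_closed C_convex A1 c1_gt0 c2_gt0 A2 A3 A4' S_into
  beta_ge0 S_demicontractive S_demiclosed eta_gt0 L_gt0 F_monotone F_Lipschitz
  rho_itv alpha_gt0 alpha_cvg alpha_sum a_gt0 betan_itv x0_in yE zE imaxP zbarE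
  tE t_in uE jmaxP xE xsVI).
Qed.
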